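(* Let $K$ be a commutative ring with unit. For every class $\mathfrak X$ of representations over $K$, $$qVar_{a.t.}\mathfrak X=\mathcal{Q}^0\mathcal{Q}^r\mathcal{S}\mathcal{C}\mathcal{C}_{up}\mathfrak X.$$
   Context: A representation $(V,G)$ over $K$ is a group $G$ together with a right $KG$-module $V$ (action written $v\circ g$). A homomorphism of representations $(\alpha,\beta):(V,G)\to(W,H)$ is a $K$-module homomorphism $\alpha:V\to W$ together with a group homomorphism $\beta:G\to H$ such that $(v\circ g)^\alpha=v^\alpha\circ g^\beta$. A subrepresentation $(V_0,G_0)\le(V,G)$ consists of a subgroup $G_0\le G$ and a $K$-submodule $V_0\le V$ that is a $KG_0$-submodule. For finite sets $X,Y$ let $F(Y)$ be the free group on $Y$, $XKF(Y)=\bigoplus_{x\in X}xKF(Y)$ the free right $KF(Y)$-module with basis $X$, and $W(X,Y)=(XKF(Y),F(Y))$. An action type quasi-identity is a formula $\left(\bigwedge_{i=1}^n(w_i=0)\right)\Rightarrow(w_0=0)$ with $w_0,\dots,w_n\in XKF(Y)$, $X,Y$ finite; $(V,G)$ satisfies it if $w_0^\alpha=0$ for every $(\alpha,\beta)\in\mathrm{Hom}(W(X,Y),(V,G))$ with $w_i^\alpha=0$ for $i=1,\dots,n$. $qVar_{a.t.}\mathfrak X$ (the action type quasi-variety generated by $\mathfrak X$) is the class of all representations over $K$ satisfying every action type quasi-identity that is satisfied by all members of $\mathfrak X$. Operators on a class $\mathfrak X$ of representations over $K$ (classes and operators are understood up to isomorphism): $\mathcal{C}\mathfrak X$ = all Cartesian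 products $(\prod_{i\in I}V_i,\prod_{i\in I}G_i)$, with componentwise action, of families of members of $\mathfrak X$ indexed by arbitrary sets $I$; $\mathcal{C}_{up}\mathfrak X$ = all filtered products of families $\{(V_i,G_i)\mid i\in I\}$ of members of $\mathfrak X$ by ultrafilters $\mathfrak F$ over $I$, i.e. $((\prod V_i)/\!\sim,(\prod G_i)/\!\sim)$ where two elements are $\sim$-equivalent iff the set of indices where they agree belongs to $\mathfrak F$, with action $[v]\circ[g]=[v\circ g]$; $\mathcal{S}\mathfrak X$ = all subrepresentations of members of $\mathfrak X$; $(V,G)\in\mathcal{Q}^r\mathfrak X$ iff there are $(V,D)\in\mathfrak X$ and a group epimorphism $\varphi:D\to G$ such that $(\mathrm{id}_V,\varphi):(V,D)\to(V,G)$ is a homomorphism of representations; $(V,G)\in\mathcal{Q}^0\mathfrak X$ iff there are $(V,D)\in\mathfrak X$ and a group epimorphism $\varphi:G\to D$ such that $(\mathrm{id}_V,\varphi):(V,G)\to(V,D)$ is a homomorphism of representations. Products of operators are compositions, applied from right to left. *)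

(* Defs.v *)
From HB Require Import structures.
From mathcomp Require Import all_boot all_order all_algebra.
From mathcomp Require Import generic_quotient.
From mathcomp Require Import finmap boolp classical_sets functions cardinality.
From mathcomp Require Import fsbigop filter.

Set Implicit Arguments.
Unset Strict Implicit.
Unset Printing Implicit Defensive.

Import GRing.Theory.
Local Open Scope ring_scope.
Local Open Scope classical_set_scope.

Notation "{ 'gmorphism' G -> H }" := (UMagmaMorphism.type G H)
  (at level 0, G at level 98, H at level 99,
   format "{ 'gmorphism'  G  ->  H }") : type_scope.

(* A right KG-module is encoded as a K-module with a K-linear right action of
   the group G. *)
Record kaction (K : comPzRingType) (V : lmodType K) (G : groupType) := KAction {
  kact :> V -> G -> V;
  kact_linear : forall g, linear (kact^~ g);
  kact1 : forall v, kact v 1%g = v;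
  kactM : forall v g h, kact v (g * h)%g = kact (kact v g) h }.

Record representation (K : comPzRingType) := Representation {
  rmod : lmodType K;
  rgrp : groupType;
  ract : kaction rmod rgrp }.

Arguments Representation {K rmod rgrp} ract.

Notation "v ∘ g" := (ract _ v g) (at level 40, left associativity) : ring_scope.

Record representation_hom (K : comPzRingType) (A B : representation K) := RepresentationHom {
  hom_mod : {linear rmod A -> rmod B};
  hom_grp : {gmorphism rgrp A -> rgrp B};
  hom_act : forall v g, hom_mod (v ∘ g) = hom_mod v ∘ hom_grp g }.

Definition representation_iso (K : comPzRingType) (A B : representation K) : Prop :=
  exists h : representation_hom A B, bijective (hom_mod h) /\ bijective (hom_grp h).

Record subrepresentation (K : comPzRingType) (A : representation K) := SubRepr {
  smod : {pred rmod A};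
  sgrp : {pred rgrp A};
  smod_closed : submod_closed smod;
  sgrp_closed : group_closed sgrp;
  sact_closed : {in smod & sgrp, forall v g, v ∘ g \in smod} }.

Section Subrepresentations.
Variables (K : comPzRingType) (A : representation K) (S : subrepresentation A).

Definition sub_mod := {v : rmod A | v \in smod S}.
Definition sub_grp := {g : rgrp A | g \in sgrp S}.

HB.instance Definition _ := SubChoice.on sub_mod.
HB.instance Definition _ := GRing.SubChoice_isSubLmodule.Build K (rmod A)
  (fun v => v \in smod S) sub_mod
  (GRing.submod_closed_semi (smod_closed S)).
HB.instance Definition _ := SubChoice.on sub_grp.
HB.instance Definition _ := SubChoice_isSubGroup.Build (rgrp A)
  (fun v => v \in sgrp S) sub_grp (sgrp_closed S).

Definition sub_act (v : sub_mod) (g : sub_grp) : sub_mod :=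
  Sub (val v ∘ val g) (sact_closed (valP v) (valP g)).

Fact sub_act_linear g : linear (sub_act^~ g).
Proof. by move=> a u v; apply: val_inj; rewrite /= kact_linear. Qed.

Fact sub_act1 v : sub_act v 1%g = v.
Proof. by apply: val_inj; rewrite /= kact1. Qed.

Fact sub_actM v g h : sub_act v (g * h)%g = sub_act (sub_act v g) h.
Proof. by apply: val_inj; rewrite /= kactM. Qed.

Definition representation_of_sub : representation K := Representation (KAction sub_act_linear sub_act1 sub_actM).

End Subrepresentations.

Section CartesianProduct.
Variables (I : Type).

Section Group.
Variable G : I -> groupType.

Definition prod_grp := forall i, G i.
HB.instance Definition _ := Choice.on prod_grp.

Let one : prod_grp := fun i => 1%g.
Let mul (x y : prod_grp) : prod_grp := fun i => (x i * y i)%g.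
Let inv (x : prod_grp) : prod_grp := fun i => (x i)^-1%g.

Let mulA : associative mul.
Proof. by move=> x y z; apply: functional_extensionality_dep => i; apply: mulgA. Qed.
Let mul1 : left_id one mul.
Proof. by move=> x; apply: functional_extensionality_dep => i; apply: mul1g. Qed.
Let mulr1 : right_id one mul.
Proof. by move=> x; apply: functional_extensionality_dep => i; apply: mulg1. Qed.
Let mulV : left_inverse one inv mul.
Proof. by move=> x; apply: functional_extensionality_dep => i; apply: mulVg. Qed.
Let mulrV : right_inverse one inv mul.
Proof. by move=> x; apply: functional_extensionality_dep => i; apply: mulgV. Qed.

HB.instance Definition _ :=
  isGroup.Build prod_grp mulA mul1 mulr1 mulV mulrV.

End Group.

Section Module.
Variables (K : comPzRingType) (V : I -> lmodType K).

Definition prod_mod := forall i, V i.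
HB.instance Definition _ := Choice.on prod_mod.

Let zero : prod_mod := fun i => 0.
Let opp (x : prod_mod) : prod_mod := fun i => - x i.
Let add (x y : prod_mod) : prod_mod := fun i => x i + y i.
Let scale (a : K) (x : prod_mod) : prod_mod := fun i => a *: x i.

Let addA : associative add.
Proof. by move=> x y z; apply: functional_extensionality_dep => i; apply: addrA. Qed.
Let addC : commutative add.
Proof. by move=> x y; apply: functional_extensionality_dep => i; apply: addrC. Qed.
Let add0 : left_id zero add.
Proof. by move=> x; apply: functional_extensionality_dep => i; apply: add0r. Qed.
Let addN : left_inverse zero opp add.
Proof. by move=> x; apply: functional_extensionality_dep => i; apply: addNr. Qed.

HB.instance Definition _ := GRing.isZmodule.Build prod_mod addA addC add0 addN.

Let scaleA a b v : scale a (scale b v) = scale (a * b) v.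
Proof. by apply: functional_extensionality_dep => i; apply: scalerA. Qed.
Let scale1 : left_id 1 scale.
Proof. by move=> x; apply: functional_extensionality_dep => i; apply: scale1r. Qed.
Let scaleDr : right_distributive scale +%R.
Proof. by move=> a x y; apply: functional_extensionality_dep => i; apply: scalerDr. Qed.
Let scaleDl v : {morph scale^~ v : a b / a + b}.
Proof. by move=> a b; apply: functional_extensionality_dep => i; apply: scalerDl. Qed.

HB.instance Definition _ :=
  GRing.Zmodule_isLmodule.Build K prod_mod scaleA scale1 scaleDr scaleDl.

End Module.

Variables (K : comPzRingType) (A : I -> representation K).

Definition prod_act (v : prod_mod (fun i => rmod (A i)))
    (g : prod_grp (fun i => rgrp (A i))) : prod_mod (fun i => rmod (A i)) :=
  fun i => v i ∘ g i.

Fact prod_act_linear g : linear (prod_act^~ g).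
Proof.
by move=> a u v; apply: functional_extensionality_dep => i; apply: kact_linear.
Qed.

Fact prod_act1 v : prod_act v 1%g = v.
Proof. by apply: functional_extensionality_dep => i; apply: kact1. Qed.

Fact prod_actM v g h : prod_act v (g * h)%g = prod_act (prod_act v g) h.
Proof. by apply: functional_extensionality_dep => i; apply: kactM. Qed.

Definition cartesian_product : representation K :=
  Representation (KAction prod_act_linear prod_act1 prod_actM).

End CartesianProduct.

Section FilteredProduct.
Local Open Scope quotient_scope.
Variables (I : Type) (F : set_system I).
Context {FF : Filter F}.

Section Agree.
Variable T : I -> choiceType.
Implicit Types x y z : forall i, T i.

Definition agree : rel (forall i, T i) :=
  fun x y => `[< F [set i | x i = y i] >].

Fact agree_refl : reflexive agree.
Proof. by move=> x; apply/asboolP; apply: filterE. Qed.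

Fact agree_sym : symmetric agree.
Proof.
by move=> x y; apply: asbool_equiv_eq; split; apply: filterS => i /= ->.
Qed.

Fact agree_trans : transitive agree.
Proof.
move=> y x z /asboolP Fxy /asboolP Fyz; apply/asboolP.
by apply: filterS2 Fxy Fyz => i /= -> ->.
Qed.

Canonical agree_equiv := EquivRel agree agree_refl agree_sym agree_trans.

Lemma agreeP x y : x = y %[mod {eq_quot agree}] <-> F [set i | x i = y i].
Proof.
by split=> [/eqmodP|Fxy]; [move=> /asboolP|apply/eqmodP/asboolP].
Qed.

Lemma agree_repr x : F [set i | repr (\pi_{eq_quot agree} x) i = x i].
Proof. by apply/agreeP; rewrite reprK. Qed.

End Agree.

Section Group.
Variable G : I -> groupType.

Definition fprod_grp := {eq_quot @agree G}.
HB.instance Definition _ := Choice.on fprod_grp.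
HB.instance Definition _ := EqQuotient.on fprod_grp.

Definition grp_class (x : prod_grp G) : fprod_grp := \pi_{eq_quot @agree G} x.

Fact grp_classP x y : grp_class x = grp_class y <-> F [set i | x i = y i].
Proof. exact: agreeP. Qed.

Fact grp_class_repr x : F [set i | repr (grp_class x) i = x i].
Proof. exact: agree_repr. Qed.

Fact grp_classW (P : fprod_grp -> Prop) :
  (forall x, P (grp_class x)) -> forall u, P u.
Proof. exact: quotW. Qed.

Let one : fprod_grp := grp_class 1%g.
Let mul (u v : fprod_grp) : fprod_grp :=
  grp_class ((repr u : prod_grp G) * (repr v : prod_grp G))%g.
Let inv (u : fprod_grp) : fprod_grp := grp_class (repr u : prod_grp G)^-1%g.

Let mulE x y : mul (grp_class x) (grp_class y) = grp_class (x * y)%g.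
Proof.
apply/grp_classP; apply: filterS2 (grp_class_repr x) (grp_class_repr y).
by move=> i /= xi yi; congr (_ * _)%g.
Qed.
Let invE x : inv (grp_class x) = grp_class x^-1%g.
Proof.
apply/grp_classP; apply: filterS (grp_class_repr x).
by move=> i /= xi; congr (_ ^-1)%g.
Qed.
Let mulA : associative mul.
Proof.
by elim/grp_classW=> x; elim/grp_classW=> y; elim/grp_classW=> z; rewrite !mulE mulgA.
Qed.
Let mul1 : left_id one mul.
Proof. by elim/grp_classW=> x; rewrite mulE mul1g. Qed.
Let mulr1 : right_id one mul.
Proof. by elim/grp_classW=> x; rewrite mulE mulg1. Qed.
Let mulV : left_inverse one inv mul.
Proof. by elim/grp_classW=> x; rewrite invE mulE mulVg. Qed.
Let mulrV : right_inverse one inv mul.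
Proof. by elim/grp_classW=> x; rewrite invE mulE mulgV. Qed.

HB.instance Definition _ :=
  isGroup.Build fprod_grp mulA mul1 mulr1 mulV mulrV.

Lemma grp_class1 : 1%g = grp_class 1%g.
Proof. by []. Qed.
Lemma grp_classM x y : grp_class (x * y)%g = (grp_class x * grp_class y)%g.
Proof. by rewrite -mulE. Qed.

End Group.

Section Module.
Variables (K : comPzRingType) (V : I -> lmodType K).

Definition fprod_mod := {eq_quot @agree V}.
HB.instance Definition _ := Choice.on fprod_mod.
HB.instance Definition _ := EqQuotient.on fprod_mod.

Definition mod_class (x : prod_mod V) : fprod_mod := \pi_{eq_quot @agree V} x.

Fact mod_classP x y : mod_class x = mod_class y <-> F [set i | x i = y i].
Proof. exact: agreeP. Qed.

Fact mod_class_repr x : F [set i | repr (mod_class x) i = x i].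
Proof. exact: agree_repr. Qed.

Fact mod_classW (P : fprod_mod -> Prop) :
  (forall x, P (mod_class x)) -> forall u, P u.
Proof. exact: quotW. Qed.

Let zero : fprod_mod := mod_class 0.
Let opp (u : fprod_mod) : fprod_mod := mod_class (- (repr u : prod_mod V)).
Let add (u v : fprod_mod) : fprod_mod :=
  mod_class ((repr u : prod_mod V) + (repr v : prod_mod V)).
Let scale (a : K) (u : fprod_mod) : fprod_mod :=
  mod_class (a *: (repr u : prod_mod V)).

Let addE x y : add (mod_class x) (mod_class y) = mod_class (x + y).
Proof.
apply/mod_classP; apply: filterS2 (mod_class_repr x) (mod_class_repr y).
by move=> i /= xi yi; congr (_ + _).
Qed.
Let oppE x : opp (mod_class x) = mod_class (- x).
Proof.
apply/mod_classP; apply: filterS (mod_class_repr x).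
by move=> i /= xi; congr (- _).
Qed.
Let scaleE a x : scale a (mod_class x) = mod_class (a *: x).
Proof.
apply/mod_classP; apply: filterS (mod_class_repr x).
by move=> i /= xi; congr (_ *: _).
Qed.

Let addA : associative add.
Proof.
by elim/mod_classW=> x; elim/mod_classW=> y; elim/mod_classW=> z; rewrite !addE addrA.
Qed.
Let addC : commutative add.
Proof. by elim/mod_classW=> x; elim/mod_classW=> y; rewrite !addE addrC. Qed.
Let add0 : left_id zero add.
Proof. by elim/mod_classW=> x; rewrite addE add0r. Qed.
Let addN : left_inverse zero opp add.
Proof. by elim/mod_classW=> x; rewrite oppE addE addNr. Qed.

HB.instance Definition _ := GRing.isZmodule.Build fprod_mod addA addC add0 addN.

Lemma mod_classD x y : mod_class (x + y) = mod_class x + mod_class y.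
Proof. by rewrite -addE. Qed.

Let scaleA a b v : scale a (scale b v) = scale (a * b) v.
Proof. by elim/mod_classW: v => x; rewrite !scaleE scalerA. Qed.
Let scale1 : left_id 1 scale.
Proof. by elim/mod_classW=> x; rewrite scaleE scale1r. Qed.
Let scaleDr : right_distributive scale +%R.
Proof.
move=> a; elim/mod_classW=> x; elim/mod_classW=> y.
by rewrite -mod_classD !scaleE scalerDr mod_classD.
Qed.
Let scaleDl v : {morph scale^~ v : a b / a + b}.
Proof. by move=> a b; elim/mod_classW: v => x; rewrite !scaleE scalerDl mod_classD. Qed.

HB.instance Definition _ :=
  GRing.Zmodule_isLmodule.Build K fprod_mod scaleA scale1 scaleDr scaleDl.

Lemma mod_classZ a x : mod_class (a *: x) = a *: mod_class x.
Proof. by rewrite -scaleE. Qed.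

End Module.

Variables (K : comPzRingType) (A : I -> representation K).

Definition fprod_act (v : fprod_mod (fun i => rmod (A i)))
    (g : fprod_grp (fun i => rgrp (A i))) : fprod_mod (fun i => rmod (A i)) :=
  mod_class (prod_act (repr v) (repr g)).

Lemma fprod_actE v g :
  fprod_act (mod_class v) (grp_class g) = mod_class (prod_act v g).
Proof.
apply/mod_classP; apply: filterS2 (mod_class_repr v) (grp_class_repr g).
by move=> i /= vi gi; rewrite /prod_act vi gi.
Qed.

Fact fprod_act_linear g : linear (fprod_act^~ g).
Proof.
elim/grp_classW: g => g a; elim/mod_classW=> u; elim/mod_classW=> v.
by rewrite -mod_classZ -mod_classD !fprod_actE prod_act_linear mod_classD mod_classZ.
Qed.

Fact fprod_act1 v : fprod_act v 1%g = v.
Proof. by elim/mod_classW: v => v; rewrite grp_class1 fprod_actE prod_act1. Qed.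

Fact fprod_actM v g h : fprod_act v (g * h)%g = fprod_act (fprod_act v g) h.
Proof.
elim/mod_classW: v => v; elim/grp_classW: g => g; elim/grp_classW: h => h.
by rewrite -grp_classM !fprod_actE prod_actM.
Qed.

Definition filtered_product : representation K :=
  Representation (KAction fprod_act_linear fprod_act1 fprod_actM).

End FilteredProduct.

Arguments filtered_product {I} F {FF K} A.

Section FreeGroup.
Variable Y : choiceType.

(* (y, false) stands for y and (y, true) for its formal inverse. *)
Definition letter : Type := (Y * bool)%type.

HB.instance Definition _ := Choice.on letter.

Implicit Types (a b : letter) (s t : seq letter).

Definition linv a : letter := (a.1, ~~ a.2).
Definition reduced s := sorted (fun a b => b != linv a) s.

Definition cons_red a s :=
  if s is b :: s' then if b == linv a then s' else a :: s else [:: a].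
Definition reduce s := foldr cons_red [::] s.

Record freegroup : predArgType :=
  FreeGroup { word :> seq letter; wordP : reduced word }.

HB.instance Definition _ := [isSub for word].
HB.instance Definition _ := [Choice of freegroup by <:].

Lemma linvK : involutive linv.
Proof. by case=> y b; rewrite /linv negbK. Qed.

Lemma reduced_cons a s : reduced (a :: s) -> reduced s.
Proof. exact: path_sorted. Qed.

Lemma reduced_cons_red a s : reduced s -> reduced (cons_red a s).
Proof.
case: s => [|b s] // red_bs; rewrite /cons_red.
case: ifP => [_|/negbT neq]; first exact: reduced_cons red_bs.
by rewrite /reduced /= neq.
Qed.

Lemma reduced_foldr s t : reduced t -> reduced (foldr cons_red t s).
Proof. by move=> red_t; elim: s => //= a s; apply: reduced_cons_red. Qed.

Lemma reduce_reduced s : reduced (reduce s).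
Proof. exact: reduced_foldr. Qed.

Lemma reduce_id s : reduced s -> reduce s = s.
Proof.
elim: s => // a s IHs red_as /=; rewrite IHs ?(reduced_cons red_as) //.
by case: s red_as {IHs} => [|b s] //= /andP[/negPf->].
Qed.

Lemma cons_redK a s : reduced s -> cons_red (linv a) (cons_red a s) = s.
Proof.
case: s => [|b s] red_s; first by rewrite /= linvK eqxx.
rewrite [cons_red a _]/=; case b_eq: (b == linv a).
  move/eqP: b_eq red_s => ->; case: s => [|c s] //= /andP[c_neq _].
  by rewrite (negPf c_neq).
by rewrite /= linvK eqxx.
Qed.

Lemma foldr_cons_red a s t : reduced t ->
  foldr cons_red t (cons_red a s) = cons_red a (foldr cons_red t s).
Proof.
case: s => [|b s] red_t //; rewrite [cons_red a (_ :: _)]/=.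
case b_eq: (b == linv a) => //; move/eqP: b_eq => ->.
have := cons_redK (linv a) (reduced_foldr s red_t).
by rewrite linvK => /esym.
Qed.

Lemma foldr_reduce s t : reduced t ->
  foldr cons_red t (reduce s) = foldr cons_red t s.
Proof.
by move=> red_t; elim: s => //= a s <-; rewrite foldr_cons_red.
Qed.

Lemma reduced_inv s : reduced s -> reduced (rev (map linv s)).
Proof.
rewrite /reduced rev_sorted sorted_map; apply: sub_sorted => a b /=.
by apply: contra => /eqP ->; rewrite linvK.
Qed.

Definition fg_one := @FreeGroup [::] isT.
Definition fg_mul (u v : freegroup) := FreeGroup (reduce_reduced (u ++ v)).
Definition fg_inv (u : freegroup) := FreeGroup (reduced_inv (wordP u)).

Lemma fg_mulE (u v : freegroup) : fg_mul u v = foldr cons_red v u :> seq _.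
Proof. by rewrite /= /reduce foldr_cat -/(reduce v) reduce_id // wordP. Qed.

Fact fg_mulA : associative fg_mul.
Proof.
move=> u v w; apply: val_inj; rewrite [LHS]fg_mulE [RHS]fg_mulE [word (fg_mul u v)]/=.
by rewrite foldr_reduce ?wordP // foldr_cat; congr foldr; apply: fg_mulE.
Qed.

Fact fg_mul1 : left_id fg_one fg_mul.
Proof. by move=> u; apply: val_inj; apply: fg_mulE. Qed.

Fact fg_mulr1 : right_id fg_one fg_mul.
Proof. by move=> u; apply: val_inj; rewrite /= cats0 reduce_id // wordP. Qed.

Lemma reduceV s : reduce (s ++ rev (map linv s)) = [::].
Proof.
rewrite /reduce; elim: s => // a s IHs /=; rewrite rev_cons -cats1 catA.
rewrite foldr_cat -(foldr_reduce (s ++ _)) //= /reduce IHs /=.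
by rewrite eqxx.
Qed.

Fact fg_mulrV : right_inverse fg_one fg_inv fg_mul.
Proof. by move=> u; apply: val_inj; apply: reduceV. Qed.

Fact fg_mulV : left_inverse fg_one fg_inv fg_mul.
Proof.
move=> u; apply: val_inj => /=.
rewrite -[X in _ ++ X](mapK linvK) -[X in _ ++ map _ X]revK -map_rev.
by rewrite [X in _ ++ X]map_rev; apply: reduceV.
Qed.

HB.instance Definition _ :=
  isGroup.Build freegroup fg_mulA fg_mul1 fg_mulr1 fg_mulV fg_mulrV.

Definition fg_gen (y : Y) : freegroup := @FreeGroup [:: (y, false)] isT.

End FreeGroup.

Section FreeRepresentation.
Variables (K : comPzRingType) (X Y : choiceType).

(* An element of XKF(Y) is the formal sum of the terms f (x, h) * (x h) over
   x in X and h in F(Y), for a finitely supported function f. *)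
Definition fin_supp : {pred X * freegroup Y -> K^o} :=
  fun f => `[< finite_set [set z | f z != 0] >].

Definition free_mod := {f : X * freegroup Y -> K^o | f \in fin_supp}.

Fact fin_supp_closed : submod_closed fin_supp.
Proof.
split=> [|a u v /asboolP fu /asboolP fv]; apply/asboolP.
  by rewrite (_ : mkset _ = set0) //; apply/seteqP; split=> z //= /eqP.
apply: (@sub_finite_set _ _ ([set z | u z != 0] `|` [set z | v z != 0])).
  move=> z /= nz; apply/orP; apply: contraR nz; rewrite negb_or !negbK.
  by move=> /andP[/eqP uz /eqP vz]; rewrite !fctE uz vz scaler0 addr0.
by rewrite finite_setU.
Qed.

HB.instance Definition _ := SubChoice.on free_mod.
HB.instance Definition _ := GRing.SubChoice_isSubLmodule.Build K
  (X * freegroup Y -> K^o) (fun f => f \in fin_supp) free_mod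
  (GRing.submod_closed_semi fin_supp_closed).

Fact fin_supp_shift (f : free_mod) (g : freegroup Y) :
  (fun z => val f (z.1, z.2 / g)%g) \in fin_supp.
Proof.
apply/asboolP; have /asboolP fin_f := valP f.
apply: (@sub_finite_set _ _ ((fun z => (z.1, z.2 * g)%g) @` [set z | val f z != 0])).
  by case=> x h /= nz; exists (x, h / g)%g => //=; rewrite mulgVK.
exact: finite_image.
Qed.

(* Right multiplication by g sends x h to x (h g); see free_term_act. *)
Definition free_act (f : free_mod) (g : freegroup Y) : free_mod :=
  Sub (fun z => val f (z.1, z.2 / g)%g) (fin_supp_shift f g).

Fact free_act_linear g : linear (free_act^~ g).
Proof. by move=> a u v; apply: val_inj. Qed.

Fact free_act1 f : free_act f 1%g = f.
Proof. by apply: val_inj; apply/funext => -[x h] /=; rewrite divg1. Qed.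

Fact free_actM f g h : free_act f (g * h)%g = free_act (free_act f g) h.
Proof. by apply: val_inj; apply/funext => -[x k] /=; rewrite invgM mulgA. Qed.

Definition free_representation : representation K :=
  Representation (KAction free_act_linear free_act1 free_actM).

End FreeRepresentation.

Section UniversalProperty.
Variables (K : comPzRingType) (X Y : choiceType).
Local Notation W := (free_representation K X Y).
Implicit Types (z : X * freegroup Y) (f : free_mod K X Y).

Fact free_term_subproof z :
  (fun z' => (z' == z)%:R : K^o) \in @fin_supp K X Y.
Proof.
apply/asboolP; apply: (@sub_finite_set _ _ [set z]) => // z' /=.
by case: (z' =P z) => // _ /eqP.
Qed.

(* The element x h of XKF(Y), for z = (x, h). *)
Definition free_term z : rmod W :=
  (Sub (fun z' => (z' == z)%:R : K^o) (free_term_subproof z) : free_mod K X Y).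
Definition free_gen (x : X) : rmod W := free_term (x, 1%g).

Lemma free_term_act z g : free_term z ∘ g = free_term (z.1, (z.2 * g)%g).
Proof.
apply: val_inj; apply/funext => -[x h]; case: z => x' h' /=.
congr (nat_of_bool _)%:R; rewrite !xpair_eqE; congr (_ && _).
by rewrite divg_eq.
Qed.

Definition fsetsupp f : {fset X * freegroup Y} :=
  fset_set [set z | val f z != 0].

Lemma fsetsuppP f z : z \notin fsetsupp f -> val f z = 0.
Proof.
have /asboolP fin_f := valP f.
by rewrite in_fset_set // notin_setE /= => /negP; rewrite negbK => /eqP.
Qed.

Lemma val_sum (I : Type) (r : seq I) (F : I -> free_mod K X Y) z :
  val (\sum_(i <- r) F i) z = \sum_(i <- r) val (F i) z.
Proof. by elim/big_rec2: _ => // i y u _ <-. Qed.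

Lemma val_scale_term (c : K) z z' :
  val (c *: (free_term z : free_mod K X Y)) z' = c * (z' == z)%:R.
Proof. by []. Qed.

Lemma free_mod_sum f :
  f = \sum_(z <- fsetsupp f) (val f z : K) *: (free_term z : free_mod K X Y).
Proof.
apply: val_inj; apply/funext => z; rewrite val_sum.
under eq_bigr => i _ do rewrite val_scale_term.
have [zf|zf] := boolP (z \in fsetsupp f); last first.
  rewrite (fsetsuppP zf) big_seq big1 // => i if_.
  by case: (z =P i) if_ zf => [<- ->|_ _ _] //; rewrite mulr0.
rewrite (bigD1_seq z) ?fset_uniq //= eqxx mulr1 big1 ?addr0 // => i.
by rewrite eq_sym => /negPf->; rewrite mulr0.
Qed.

Section Extension.
Variables (A : representation K) (a : X -> rmod A) (b : Y -> rgrp A).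

Definition letter_val (l : letter Y) : rgrp A :=
  if l.2 then (b l.1)^-1%g else b l.1.
Definition word_val (s : seq (letter Y)) : rgrp A :=
  foldr (fun l g => letter_val l * g)%g 1%g s.

Lemma letter_valV l : letter_val (linv l) = (letter_val l)^-1%g.
Proof. by case: l => y [] //=; rewrite /letter_val /= invgK. Qed.

Lemma word_val_cons_red l s :
  word_val (cons_red l s) = (letter_val l * word_val s)%g.
Proof.
case: s => [|m s] //=; case E: (m == linv l) => //.
by move/eqP: E => ->; rewrite letter_valV mulVKg.
Qed.

Lemma word_val_foldr s t :
  word_val (foldr (@cons_red Y) t s) = (word_val s * word_val t)%g.
Proof.
elim: s => [|l s IHs] /=; first by rewrite mul1g.
by rewrite word_val_cons_red IHs mulgA.
Qed.

Definition fg_val (u : freegroup Y) : rgrp A := word_val u.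

Fact fg_val_morph : monoid.monoid_morphism fg_val.
Proof. by split=> // u v; rewrite /fg_val fg_mulE word_val_foldr. Qed.

HB.instance Definition _ :=
  isUMagmaMorphism.Build (freegroup Y) (rgrp A) fg_val fg_val_morph.

Definition term_val z : rmod A := a z.1 ∘ fg_val z.2.
Definition free_val f : rmod A := \sum_(z \in [set: _]) (val f z : K) *: term_val z.

Lemma free_valE (D : {fset X * freegroup Y}) f :
  (forall z, z \notin D -> val f z = 0) ->
  free_val f = \sum_(z <- D) (val f z : K) *: term_val z.
Proof. by move=> Df; apply: fsbigTE => z /Df ->; rewrite scale0r. Qed.

Fact free_val_linear : linear free_val.
Proof.
move=> c u v; pose D := (fsetsupp u `|` fsetsupp v)%fset.
have Du z : z \notin D -> val u z = 0.
  by rewrite in_fsetU negb_or => /andP[/fsetsuppP].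
have Dv z : z \notin D -> val v z = 0.
  by rewrite in_fsetU negb_or => /andP[_ /fsetsuppP].
rewrite (free_valE Du) (free_valE Dv) (@free_valE D) => [|z zD]; last first.
  by rewrite /= !fctE Du // Dv // scaler0 addr0.
rewrite scaler_sumr -big_split /=; apply: eq_bigr => z _.
by rewrite scalerA -scalerDl.
Qed.

HB.instance Definition _ :=
  GRing.isLinear.Build K (free_mod K X Y) (rmod A) *:%R free_val free_val_linear.

Lemma free_val_term z : free_val (free_term z) = term_val z.
Proof.
rewrite (@free_valE [fset z]%fset) => [|z']; last first.
  by rewrite in_fset1 /= => /negPf->.
by rewrite big_seq_fset1 /= eqxx scale1r.
Qed.

Lemma linear_free_ext (f g : {linear rmod W -> rmod A}) :
  (forall z, f (free_term z) = g (free_term z)) -> f =1 g.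
Proof.
move=> fg u; rewrite (free_mod_sum u) !linear_sum; apply: eq_bigr => z _.
by rewrite !linearZ /= fg.
Qed.

Fact free_val_act (v : rmod W) (g : rgrp W) :
  free_val (v ∘ g) = free_val v ∘ fg_val g.
Proof.
have lin := @kact_linear _ _ _ (ract W) g.
have lin' := @kact_linear _ _ _ (ract A) (fg_val g).
pose L := GRing.isLinear.Build K (rmod W) (rmod W) *:%R _ lin.
pose f : {linear rmod W -> rmod W} := HB.pack (fun v : rmod W => v ∘ g) L.
pose L' := GRing.isLinear.Build K (rmod A) (rmod A) *:%R _ lin'.
pose f' : {linear rmod A -> rmod A} := HB.pack (fun v : rmod A => v ∘ fg_val g) L'.
pose h : {linear rmod W -> rmod A} := free_val.
apply: (@linear_free_ext (h \o f) (f' \o h)) => z.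
rewrite -[LHS]/(free_val (free_term z ∘ g)).
rewrite -[RHS]/(free_val (free_term z) ∘ fg_val g).
rewrite free_term_act !free_val_term /term_val /=.
by rewrite gmulfM kactM.
Qed.

Definition free_hom : representation_hom W A :=
  @RepresentationHom K W A free_val fg_val free_val_act.

Lemma fg_hom_ext (f g : {gmorphism freegroup Y -> rgrp A}) :
  (forall y, f (fg_gen y) = g (fg_gen y)) -> f =1 g.
Proof.
move=> fg [s red_s]; elim: s red_s => [|l s IHs] red_s.
  by rewrite -[FreeGroup _](_ : 1%g = _) ?gmulf1 //; apply: val_inj.
have red_l : reduced [:: l] by [].
have -> : FreeGroup red_s = (FreeGroup red_l * FreeGroup (reduced_cons red_s))%g.
  by apply: val_inj; rewrite /= -[LHS](reduce_id red_s).
rewrite !gmulfM IHs; congr (_ * _)%g.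
have lE : FreeGroup red_l = if l.2 then (fg_gen l.1)^-1%g else fg_gen l.1.
  by apply: val_inj; case: l red_s red_l => y [].
by rewrite lE; case: (l.2); rewrite ?gmulfV fg.
Qed.

Theorem free_representation_universal :
  exists h : representation_hom W A,
    [/\ forall x, hom_mod h (free_gen x) = a x,
        forall y, hom_grp h (fg_gen y) = b y
      & forall h' : representation_hom W A,
          (forall x, hom_mod h' (free_gen x) = a x) ->
          (forall y, hom_grp h' (fg_gen y) = b y) ->
          hom_mod h' =1 hom_mod h /\ hom_grp h' =1 hom_grp h].
Proof.
have hx x : hom_mod free_hom (free_gen x) = a x.
  by rewrite /= free_val_term /term_val /= kact1.
have hy y : hom_grp free_hom (fg_gen y) = b y.
  by rewrite /= /fg_val /= /letter_val /= mulg1.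
exists free_hom; split=> // h' h'x h'y.
have hg : hom_grp h' =1 hom_grp free_hom.
  by apply: fg_hom_ext => y; rewrite h'y hy.
split=> //; apply: linear_free_ext => -[x g].
have -> : free_term (x, g) = free_gen x ∘ g by rewrite free_term_act /= mul1g.
by rewrite !hom_act h'x hx hg.
Qed.

End Extension.
End UniversalProperty.

Definition repr_class (K : comPzRingType) : Type := representation K -> Prop.

Record quasi_identity (K : comPzRingType) := QuasiIdentity {
  qi_X : finType;
  qi_Y : finType;
  qi_size : nat;
  qi_premise : 'I_qi_size -> rmod (free_representation K qi_X qi_Y);
  qi_conclusion : rmod (free_representation K qi_X qi_Y) }.

Definition satisfies (K : comPzRingType) (A : representation K)
    (q : quasi_identity K) : Prop :=
  forall h : representation_hom (free_representation K (qi_X q) (qi_Y q)) A,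
    (forall i, hom_mod h (qi_premise i) = 0) ->
    hom_mod h (qi_conclusion q) = 0.

Definition qVar_at (K : comPzRingType) (X : repr_class K) : repr_class K :=
  fun A => forall q, (forall B, X B -> satisfies B q) -> satisfies A q.

(* Each operator is read up to isomorphism: it returns every representation
   isomorphic to one obtained from members of X by the construction. *)

Section Operators.
Variable K : comPzRingType.
Implicit Types X : repr_class K.

Definition op_C X : repr_class K :=
  fun A => exists (I : Type) (B : I -> representation K),
     (forall i, X (B i)) /\ representation_iso (cartesian_product B) A.

Definition op_Cup X : repr_class K :=
  fun A => exists (I : Type) (F : set_system I) (UF : UltraFilter F)
     (B : I -> representation K),
     (forall i, X (B i)) /\ representation_iso (filtered_product F B) A.

Definition op_S X : repr_class K :=
  fun A => exists (B : representation K) (S : subrepresentation B),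
     X B /\ representation_iso (representation_of_sub S) A.

(* The condition hom_mod h =1 id says that h has the form (id_V, phi). *)
Definition op_Qr X : repr_class K :=
  fun A => exists (V : lmodType K) (D G : groupType)
     (actD : kaction V D) (actG : kaction V G)
     (h : representation_hom (Representation actD) (Representation actG)),
     [/\ X (Representation actD), hom_mod h =1 id, range (hom_grp h) = setT
       & representation_iso (Representation actG) A].

Definition op_Q0 X : repr_class K :=
  fun A => exists (V : lmodType K) (D G : groupType)
     (actD : kaction V D) (actG : kaction V G)
     (h : representation_hom (Representation actG) (Representation actD)),
     [/\ X (Representation actD), hom_mod h =1 id, range (hom_grp h) = setT
       & representation_iso (Representation actG) A].

End Operators.

(* Main.v *)
(* Let A = (V, G) satisfy all the quasi-identities of X, and let p : W -> A be
   the canonical map from the free representation on the sets V and G.  Given w0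
   outside ker p and finitely many elements of ker p, the failure in A of the
   quasi-identity they form yields a homomorphism from W to a member of X that
   kills these elements but not w0.  An ultraproduct over the finite lists in
   ker p kills all of ker p at once, still not w0, and the product over all w0
   gives h : W -> B in C C_up X with ker h = ker p on the modules.  Hence V
   embeds in the module of B; a subrepresentation (V, D) of B has D acting on V
   through the same automorphisms as G, so Q^r reaches (V, G / C) and Q^0 then
   reaches (V, G), where C is the kernel of the action of G on V. *)
Require Import Defs.
From HB Require Import structures.
From mathcomp Require Import all_boot all_algebra.
From mathcomp Require Import finmap boolp classical_sets filter.

Set Implicit Arguments.
Unset Strict Implicit.
Unset Printing Implicit Defensive.

Import GRing.Theory.
Local Open Scope ring_scope.
Local Open Scope classical_set_scope.

(** * Homomorphisms, isomorphisms and lifting of maps from free representations *)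

Section Homomorphisms.
Variable K : comPzRingType.
Implicit Types A B C : representation K.

Definition build_linear (U V : lmodType K) (f : U -> V) (lf : linear f) :
  {linear U -> V} := HB.pack f (GRing.isLinear.Build K U V *:%R f lf).

Definition build_gmorphism (G H : groupType) (f : G -> H)
    (mf : monoid.monoid_morphism f) : {gmorphism G -> H} :=
  HB.pack f (isUMagmaMorphism.Build G H f mf).

Definition build_hom A B (f : rmod A -> rmod B) (g : rgrp A -> rgrp B)
    (lf : linear f) (mg : monoid.monoid_morphism g)
    (fg : forall v x, f (v ∘ x) = f v ∘ g x) : representation_hom A B :=
  @RepresentationHom K A B (build_linear lf) (build_gmorphism mg) fg.

Lemma id_gmorphism (G : groupType) : monoid.monoid_morphism (@id G).
Proof. by []. Qed.

Lemma id_linear (V : lmodType K) : linear (@id V).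
Proof. by []. Qed.

Definition hom_id A : representation_hom A A :=
  @build_hom A A id id (@id_linear _) (@id_gmorphism _) (fun _ _ => erefl).

Lemma comp_act A B C (k : representation_hom B C) (h : representation_hom A B) v x :
  hom_mod k (hom_mod h (v ∘ x)) = hom_mod k (hom_mod h v) ∘ hom_grp k (hom_grp h x).
Proof. by rewrite !hom_act. Qed.

Lemma comp_linear A B C (k : representation_hom B C) (h : representation_hom A B) :
  linear (fun v => hom_mod k (hom_mod h v)).
Proof. by move=> a u v; rewrite !linearP. Qed.

Lemma comp_gmorphism A B C (k : representation_hom B C) (h : representation_hom A B) :
  monoid.monoid_morphism (fun x => hom_grp k (hom_grp h x)).
Proof. by split=> [|x y]; rewrite ?gmulf1 ?gmulfM. Qed.

Definition hom_comp A B C (k : representation_hom B C) (h : representation_hom A B) :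
    representation_hom A C :=
  build_hom (comp_linear k h) (comp_gmorphism k h) (comp_act k h).

Lemma iso_refl A : representation_iso A A.
Proof. by exists (hom_id A); split; exists id. Qed.

Lemma iso_sym A B : representation_iso A B -> representation_iso B A.
Proof.
case=> h [[f fK Kf] [g gK Kg]].
have lf : linear f.
  by move=> a u v; apply: (can_inj fK); rewrite Kf linearP !Kf.
have mg : monoid.monoid_morphism g.
  by split=> [|x y]; apply: (can_inj gK); rewrite Kg ?gmulf1 ?gmulfM ?Kg.
have fg v x : f (v ∘ x) = f v ∘ g x.
  by apply: (can_inj fK); rewrite hom_act !Kf Kg.
by exists (build_hom lf mg fg); split; [exists (hom_mod h)|exists (hom_grp h)].
Qed.

Lemma free_hom_ext (X Y : choiceType) A
    (h k : representation_hom (free_representation K X Y) A) :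
  (forall x, hom_mod h (free_gen K Y x) = hom_mod k (free_gen K Y x)) ->
  (forall y, hom_grp h (fg_gen y) = hom_grp k (fg_gen y)) ->
  hom_mod h =1 hom_mod k.
Proof.
move=> hkX hkY.
have [l [lX lY uniq]] := free_representation_universal
  (fun x => hom_mod k (free_gen K Y x)) (fun y => hom_grp k (fg_gen y)).
have [hE _] := uniq h hkX hkY.
have [kE _] := uniq k (fun _ => erefl) (fun _ => erefl).
by move=> w; rewrite hE kE.
Qed.

(** Projectivity of free representations: send each generator to a chosen preimage and compare the
    two maps to [B] on generators. *)
Lemma free_hom_lift (X Y : choiceType) A B (p : representation_hom A B)
    (h : representation_hom (free_representation K X Y) B) :
  (forall v, exists u, hom_mod p u = v) -> (forall x, exists y, hom_grp p y = x) ->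
  exists k : representation_hom (free_representation K X Y) A,
    forall w, hom_mod p (hom_mod k w) = hom_mod h w.
Proof.
move=> pV pG.
have [a pa] := choice (fun x => pV (hom_mod h (free_gen K Y x))).
have [b pb] := choice (fun y => pG (hom_grp h (fg_gen y))).
have [k [kX kY _]] := free_representation_universal a b.
exists k; apply: (@free_hom_ext _ _ _ (hom_comp p k)) => z /=.
  by rewrite kX pa.
by rewrite kY pb.
Qed.

End Homomorphisms.

(** * Preservation of quasi-identities by the operators *)

Section Soundness.
Variable K : comPzRingType.
Implicit Types (A B : representation K) (q : quasi_identity K) (X : repr_class K).

(** Injectivity is asked of the module part only, so this serves both [op_S] and [op_Q0]. *)
Lemma satisfies_inj A B (h : representation_hom A B) q :
  injective (hom_mod h) -> satisfies B q -> satisfies A q.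
Proof.
move=> inj_h Bq k kq; apply: inj_h; rewrite linear0.
by apply: (Bq (hom_comp h k)) => i /=; rewrite kq linear0.
Qed.

(* Homomorphisms from a free representation lift along p, and the premises
   survive because p is injective on the module. *)
Lemma satisfies_onto A B (p : representation_hom A B) q :
  bijective (hom_mod p) -> (forall x, exists y, hom_grp p y = x) ->
  satisfies A q -> satisfies B q.
Proof.
move=> [f fK Kf] pG Aq h hq.
have [|k kE] := free_hom_lift h _ pG; first by move=> v; exists (f v).
rewrite -kE Aq ?linear0 // => i.
by apply: (can_inj fK); rewrite kE hq linear0.
Qed.

Lemma satisfies_iso A B q : representation_iso A B -> satisfies A q -> satisfies B q.
Proof.
by case=> h [bV [g _ Kg]]; apply: satisfies_onto bV _ => x; exists (g x).
Qed.

Lemma satisfies_sub A (S : subrepresentation A) q :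
  satisfies A q -> satisfies (representation_of_sub S) q.
Proof.
have lf : linear (fun v : rmod (representation_of_sub S) => val v) by [].
have mg : monoid.monoid_morphism (fun x : rgrp (representation_of_sub S) => val x) by [].
exact: (@satisfies_inj _ _ (@build_hom _ _ A _ _ lf mg (fun _ _ => erefl)) _ val_inj).
Qed.

Section Products.
Variables (I : Type) (B : I -> representation K).

Definition prod_proj i : representation_hom (cartesian_product B) (B i) :=
  @build_hom K (cartesian_product B) (B i) (fun v => v i) (fun x => x i)
    (fun _ _ _ => erefl) (erefl, fun _ _ => erefl) (fun _ _ => erefl).

Lemma satisfies_product q :
  (forall i, satisfies (B i) q) -> satisfies (cartesian_product B) q.
Proof.
move=> Bq h hq; apply: functional_extensionality_dep => i.
by apply: (Bq i (hom_comp (prod_proj i) h)) => j /=; rewrite hq.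
Qed.

Lemma product_hom A (h : forall i, representation_hom A (B i)) :
  exists k : representation_hom A (cartesian_product B),
    forall v i, hom_mod k v i = hom_mod (h i) v.
Proof.
pose f (v : rmod A) : rmod (cartesian_product B) := fun i => hom_mod (h i) v.
pose g (x : rgrp A) : rgrp (cartesian_product B) := fun i => hom_grp (h i) x.
have lf : linear f.
  by move=> a u v; apply: functional_extensionality_dep => i; apply: linearP.
have mg : monoid.monoid_morphism g.
  by split=> [|x y]; apply: functional_extensionality_dep => i;
    rewrite /g ?gmulf1 ?gmulfM.
have fg v x : f (v ∘ x) = f v ∘ g x.
  by apply: functional_extensionality_dep => i; apply: hom_act.
by exists (build_hom lf mg fg).
Qed.

Variables (F : set_system I).
Context {FF : Filter F}.

Lemma class_linear : linear (@mod_class I F FF K (fun i => rmod (B i))).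
Proof. by move=> a u v; rewrite mod_classD mod_classZ. Qed.

Lemma class_gmorphism :
  monoid.monoid_morphism (@grp_class I F FF (fun i => rgrp (B i))).
Proof. by split=> // x y; rewrite grp_classM. Qed.

Definition class_hom :
    representation_hom (cartesian_product B) (filtered_product F B) :=
  @build_hom K (cartesian_product B) (filtered_product F B) _ _
    class_linear class_gmorphism (fun v g => esym (fprod_actE v g)).

Lemma class_hom_eq0 v :
  hom_mod class_hom v = 0 <-> F [set i | v i = 0].
Proof. by exact: mod_classP. Qed.

Lemma satisfies_filtered q :
  (forall i, satisfies (B i) q) -> satisfies (filtered_product F B) q.
Proof.
move=> Bq h hq.
have [v|x|k kE] := free_hom_lift (p := class_hom) h.
- by elim/mod_classW: v => v; exists v.
- by elim/grp_classW: x => x; exists x.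
rewrite -kE; apply/class_hom_eq0.
(* Each lifted premise vanishes on a set of [F]; there are finitely many, so they vanish together on
   one. *)
have : F [set i | forall j, hom_mod k (qi_premise j) i = 0].
  by apply: filter_forall => j; apply/class_hom_eq0; rewrite kE hq.
by apply: filterS => i; apply: (Bq i (hom_comp (prod_proj i) k)).
Qed.

End Products.

Lemma qVar_operators X A :
  op_Q0 (op_Qr (op_S (op_C (op_Cup X)))) A -> qVar_at X A.
Proof.
move=> XA q Xq.
have CupP B : op_Cup X B -> satisfies B q.
  move=> [I [F [UF [C [XC isoB]]]]]; apply: satisfies_iso isoB _.
  by apply: satisfies_filtered => i; apply: Xq.
have CP B : op_C (op_Cup X) B -> satisfies B q.
  move=> [I [C [XC isoB]]]; apply: satisfies_iso isoB _.
  by apply: satisfies_product => i; apply: CupP.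
have SP B : op_S (op_C (op_Cup X)) B -> satisfies B q.
  move=> [C [S [XC isoB]]]; apply: satisfies_iso isoB _.
  exact/satisfies_sub/CP.
have QrP B : op_Qr (op_S (op_C (op_Cup X))) B -> satisfies B q.
  move=> [V [D [G [actD [actG [h [XD hV hG isoB]]]]]]].
  apply: satisfies_iso isoB _; apply: (satisfies_onto (p := h) _ _ (SP _ XD)).
    by exists id => v; [exact: hV|rewrite hV].
  by move=> x; have [y _ yx] : range (hom_grp h) x by [rewrite hG]; exists y.
move: XA => [V [D [G [actD [actG [h [XD hV hG isoA]]]]]]].
apply: satisfies_iso isoA _; apply: (satisfies_inj (h := h) _ (QrP _ XD)).
by move=> u v; rewrite !hV.
Qed.

End Soundness.

(** * Reduction to finitely many variables *)

Section FiniteSupport.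
Variables (K : comPzRingType) (X Y : choiceType).
Local Notation W := (free_representation K X Y).

Lemma word_hom_ext (G : groupType) (f g : {gmorphism freegroup Y -> G}) (u : freegroup Y) :
  (forall l, l \in word u -> f (fg_gen l.1) = g (fg_gen l.1)) -> f u = g u.
Proof.
case: u => s red_s; elim: s red_s => [|l s IHs] red_s fg.
  by rewrite -[FreeGroup _](_ : 1%g = _) ?gmulf1 //; apply: val_inj.
have red_l : reduced [:: l] by [].
have -> : FreeGroup red_s = (FreeGroup red_l * FreeGroup (reduced_cons red_s))%g.
  by apply: val_inj; rewrite /= -[LHS](reduce_id red_s).
rewrite !gmulfM IHs => [|m ms]; last by apply: fg; rewrite inE orbC; apply/orP; left.
have fgl : f (fg_gen l.1) = g (fg_gen l.1) by apply: fg; apply: mem_head.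
have -> : FreeGroup red_l = if l.2 then (fg_gen l.1)^-1%g else fg_gen l.1.
  by apply: val_inj; case: (l) => y [].
by case: (l.2); rewrite ?gmulfV fgl.
Qed.

(** An element is a finite sum of terms x u, and the value of such a term depends only on x and the
    letters of u. *)
Lemma free_hom_finite_support (L : seq (rmod W)) :
  exists (sX : seq X) (sY : seq Y),
    forall A (h k : representation_hom W A),
      {in sX, forall x, hom_mod h (free_gen K Y x) = hom_mod k (free_gen K Y x)} ->
      {in sY, forall y, hom_grp h (fg_gen y) = hom_grp k (fg_gen y)} ->
      {in L, hom_mod h =1 hom_mod k}.
Proof.
pose terms := flatten [seq (fsetsupp w : seq _) | w <- L].
exists [seq z.1 | z <- terms], [seq l.1 | z <- terms, l <- word z.2].
move=> A h k hkX hkY w wL; rewrite (free_mod_sum w) !linear_sum.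
apply: eq_big_seq => -[x u] zw; rewrite !linearZ; congr (_ *: _).
have zT : (x, u) \in terms by apply/flattenP; exists (fsetsupp w : seq _) => //; apply: (map_f (fun w => fsetsupp w : seq _)).
have -> : free_term K (x, u) = free_gen K Y x ∘ u by rewrite free_term_act /= mul1g.
rewrite !hom_act hkX; last exact: (map_f fst zT).
congr (_ ∘ _); apply: word_hom_ext => l lu; apply: hkY.
exact: (allpairs_f_dep (fun z (m : letter Y) => m.1) zT lu).
Qed.

(** Quasi-identities have finite sets of variables, while [W] may have arbitrary ones; [i] and [r]
    pass between the two without changing [L]. *)
Lemma free_finite_retract (L : seq (rmod W)) :
  exists (X0 Y0 : finType)
    (i : representation_hom (free_representation K X0 Y0) W)
    (r : representation_hom W (free_representation K X0 Y0)),
    {in L, forall w, hom_mod i (hom_mod r w) = w}.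
Proof.
have [sX [sY LE]] := free_hom_finite_support L.
pose X0 : finType := seq_sub sX; pose Y0 : finType := seq_sub sY.
have [i [iX iY _]] := free_representation_universal
  (fun x : X0 => free_gen K Y (val x)) (fun y : Y0 => fg_gen (val y) : rgrp W).
(* Generators outside the support go to the default values 0 and 1. *)
have [r [rX rY _]] := free_representation_universal
  (fun x => oapp (@free_gen K X0 Y0) 0 (insub x))
  (fun y => oapp (@fg_gen Y0) 1%g (insub y) : rgrp (free_representation K X0 Y0)).
exists X0, Y0, i, r; apply: (LE _ (hom_comp i r) (hom_id W)) => [x xs|y ys] /=.
  by rewrite rX insubT /= iX.
by rewrite rY insubT /= iY.
Qed.

End FiniteSupport.

(** * Separation of points from the kernel of [p] *)

Section Separation.
Variables (K : comPzRingType) (X : repr_class K) (A : representation K).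
Hypothesis XA : qVar_at X A.
Variables (U Y : choiceType) (p : representation_hom (free_representation K U Y) A).
Local Notation W := (free_representation K U Y).

(* If no such member existed, A would satisfy the quasi-identity whose premises
   are L and whose conclusion is w0, rewritten in finitely many variables. *)
Lemma separate_finite (L : seq (rmod W)) (w0 : rmod W) :
  {in L, forall w, hom_mod p w = 0} -> hom_mod p w0 <> 0 ->
  exists B (h : representation_hom W B),
    [/\ X B, {in L, forall w, hom_mod h w = 0} & hom_mod h w0 <> 0].
Proof.
move=> pL pw0; have [X0 [Y0 [i [r irE]]]] := free_finite_retract (w0 :: L).
pose q := @QuasiIdentity K X0 Y0 (size L)
  (fun j => hom_mod r (tnth (in_tuple L) j)) (hom_mod r w0).
apply: contrapT => noB; apply: pw0; rewrite -(irE w0) ?mem_head //.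
(* Evaluated at [p] after [i], the formula [q] says that [p] kills [w0] if it kills [L]. *)
have Aq : satisfies A q; last first.
  apply: (Aq (hom_comp p i)) => j /=.
  by rewrite irE ?pL ?inE ?mem_tnth ?orbT.
apply: XA => B XB h hL.
(* A failure [h] of [q] in [B], precomposed with [r], is a separating homomorphism on [W]. *)
apply: contrapT => hw0; apply: noB; exists B, (hom_comp h r); split=> // w wL.
have [j ->] : exists j, w = tnth (in_tuple L) j by apply/tnthP.
exact: hL.
Qed.

Lemma separate_kernel (w0 : rmod W) : hom_mod p w0 <> 0 ->
  exists B (h : representation_hom W B),
    [/\ op_Cup X B, forall w, hom_mod p w = 0 -> hom_mod h w = 0
      & hom_mod h w0 <> 0].
Proof.
move=> pw0; pose T := {w : rmod W | hom_mod p w == 0}; pose I := seq T.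
have sep (L : I) : exists Bh : {B : representation K & representation_hom W B},
    [/\ X (projT1 Bh), {in map val L, forall w, hom_mod (projT2 Bh) w = 0}
      & hom_mod (projT2 Bh) w0 <> 0].
  have [|B [h Bh]] := @separate_finite (map val L) w0 _ pw0.
    by move=> w /mapP[u _ ->]; apply/eqP/(valP u).
  by exists (existT _ B h).
have [Bh BhP] := choice sep.
pose B L := projT1 (Bh L); pose h L : representation_hom W (B L) := projT2 (Bh L).
have [k kE] := product_hom h.
(* The base sets are the cones of lists containing [L]. The cones of [L1] and [L2] both contain that
   of [L1 ++ L2], and each cone contains its own [L], so the filter is proper. *)
pose F : set_system I := filter_from setT (fun L : seq T => [set L' : seq T | {subset L <= L'}]).
have FF : ProperFilter F.
  apply: filter_from_proper; last by move=> L _; exists L => x.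
  apply: filter_from_filter; first by exists [::].
  move=> L1 L2 _ _; exists (L1 ++ L2) => // L' sub.
  by split=> x xL; apply: sub; rewrite mem_cat xL ?orbT.
have [G [UG FG]] := ultraFilterLemma FF.
exists (filtered_product G B), (hom_comp (class_hom B (F := G)) k); split=> [|w pw|].
- exists I, G, UG, B; split=> [L|]; first by case: (BhP L).
  exact: iso_refl.
(* Every index in the cone of the one-element list of [w] kills [w]. *)
- have pw0' : hom_mod p w == 0 by apply/eqP.
  apply/class_hom_eq0; apply: FG; exists [:: exist _ w pw0'] => // L sub.
  rewrite /= kE; have [_ hL _] := BhP L; apply: hL.
  by apply/mapP; exists (exist _ w pw0') => //; apply: sub; rewrite mem_head.
(* No factor kills [w0], so otherwise the empty set would lie in [G]. *)
- move/class_hom_eq0 => /= Gw0; apply: (@filter_not_empty _ G).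
  apply: filterS Gw0 => L /=; by rewrite kE; case: (BhP L).
Qed.

(** If [p] is zero on the module, the index set is empty and the product is the trivial
    representation. *)
Lemma kernel_hom :
  exists B (h : representation_hom W B),
    op_C (op_Cup X) B /\ forall w, hom_mod h w = 0 <-> hom_mod p w = 0.
Proof.
pose I := {w : rmod W | hom_mod p w != 0}.
have sep (i : I) : exists Bh : {B : representation K & representation_hom W B},
    [/\ op_Cup X (projT1 Bh), forall w, hom_mod p w = 0 -> hom_mod (projT2 Bh) w = 0
      & hom_mod (projT2 Bh) (val i) <> 0].
  have /eqP pi := valP i; have [B [h Bh]] := separate_kernel pi.
  by exists (existT _ B h).
have [Bh BhP] := choice sep.
pose B i := projT1 (Bh i); pose h i : representation_hom W (B i) := projT2 (Bh i).
have [k kE] := product_hom h.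
exists (cartesian_product B), k; split=> [|w].
  exists I, B; split=> [i|]; first by case: (BhP i).
  exact: iso_refl.
split=> [kw|pw]; last first.
  by apply: functional_extensionality_dep => i; rewrite kE; have [_ hp _] := BhP i; apply: hp.
apply: contrapT => /eqP pw; have [_ _] := BhP (exist _ w pw).
by rewrite -(kE w (exist _ w pw)) kw.
Qed.

End Separation.

(** * The group of transformations of V induced by G *)

Section ActionImage.
Variables (K : comPzRingType) (V : lmodType K) (G : groupType) (a : kaction V G).

Definition act_image_pred : {pred V -> V} := fun f => `[< exists g, f = a^~ g >].
(** This is G modulo the kernel of its action, realised by maps of V so that a second group acting
    through the same maps can project onto it. *)
Definition act_image := {f : V -> V | f \in act_image_pred}.

HB.instance Definition _ := SubChoice.on act_image.

Lemma act_imageP g : (a^~ g : V -> V) \in act_image_pred.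
Proof. by apply/asboolP; exists g. Qed.

Definition to_image (g : G) : act_image := exist _ (a^~ g : V -> V) (act_imageP g).

Lemma to_image_surj p : exists g, to_image g = p.
Proof.
by have /asboolP[g pE] := valP p; exists g; apply: val_inj; rewrite pE.
Qed.

Lemma to_image_eq g h : to_image g = to_image h <-> forall v, a v g = a v h.
Proof.
split=> [/(congr1 val) /= gh v|gh]; first exact: (congr1 (@^~ v) gh).
by apply: val_inj; apply/funext.
Qed.

Let rep p : G := projT1 (cid (to_image_surj p)).
Let repK p : to_image (rep p) = p.
Proof. by rewrite /rep; case: cid. Qed.

Let mul p q := to_image (rep p * rep q)%g.
Let inv p := to_image (rep p)^-1%g.

Let mulE g h : mul (to_image g) (to_image h) = to_image (g * h)%g.
Proof.
have /to_image_eq gE := repK (to_image g); have /to_image_eq hE := repK (to_image h).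
by apply/to_image_eq => v; rewrite !kactM gE hE.
Qed.

Let imageW (P : act_image -> Prop) : (forall g, P (to_image g)) -> forall p, P p.
Proof. by move=> Pg p; rewrite -(repK p). Qed.

Let mulA : associative mul.
Proof. by elim/imageW=> g; elim/imageW=> h; elim/imageW=> k; rewrite !mulE mulgA. Qed.
Let mul1 : left_id (to_image 1%g) mul.
Proof. by elim/imageW=> g; rewrite mulE mul1g. Qed.
Let mulr1 : right_id (to_image 1%g) mul.
Proof. by elim/imageW=> g; rewrite mulE mulg1. Qed.
Let mulV : left_inverse (to_image 1%g) inv mul.
Proof. by move=> p; rewrite -{2}(repK p) mulE mulVg. Qed.
Let mulrV : right_inverse (to_image 1%g) inv mul.
Proof. by move=> p; rewrite -{1}(repK p) mulE mulgV. Qed.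

HB.instance Definition _ :=
  isGroup.Build act_image mulA mul1 mulr1 mulV mulrV.

Lemma to_image_gmorphism : monoid.monoid_morphism to_image.
Proof. by split=> // g h; rewrite -mulE. Qed.

Definition image_act (v : V) (p : act_image) : V := val p v.

Lemma image_act_linear p : linear (image_act^~ p).
Proof. by have [g <-] := to_image_surj p; apply: kact_linear. Qed.

Lemma image_act1 v : image_act v 1%g = v.
Proof. exact: kact1. Qed.

Lemma image_actM v p q : image_act v (p * q)%g = image_act (image_act v p) q.
Proof.
have [g <-] := to_image_surj p; have [h <-] := to_image_surj q.
by rewrite -to_image_gmorphism; apply: kactM.
Qed.

Definition image_kaction : kaction V act_image :=
  KAction image_act_linear image_act1 image_actM.

End ActionImage.

(* The pair (θ V, D), where D consists of the elements of the group of B acting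
   on θ V as some element of the group of A, is a subrepresentation of B, and
   both D and the group of A map onto the group of automorphisms of V induced by A. *)
Section Embedding.
Variables (K : comPzRingType) (A B : representation K).
Variable θ : {linear rmod A -> rmod B}.
Hypothesis inj_θ : injective θ.
Hypothesis θ_act : forall g, exists d, forall v, θ (v ∘ g) = θ v ∘ d.

Let M : {pred rmod B} := fun w => `[< exists v, θ v = w >].
Let D : {pred rgrp B} := fun d => `[< exists g, forall v, θ (v ∘ g) = θ v ∘ d >].

Let M_closed : submod_closed M.
Proof.
split=> [|c _ _ /asboolP[u <-] /asboolP[v <-]]; apply/asboolP.
  by exists 0; rewrite linear0.
by exists (c *: u + v); rewrite linearP.
Qed.

Let D_closed : group_closed D.
Proof.
split=> [|d e /asboolP[g gE] /asboolP[h hE]]; apply/asboolP.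
  by exists 1%g => v; rewrite !kact1.
have hV v : θ (v ∘ h^-1%g) = θ v ∘ e^-1%g.
  by rewrite -{2}(kact1 (ract A) v) -(mulVg h) kactM hE -kactM mulgV kact1.
by exists (g / h)%g => v; rewrite kactM hV gE -kactM.
Qed.

Let act_closed : {in M & D, forall w d, w ∘ d \in M}.
Proof.
move=> _ d /asboolP[v <-] /asboolP[g gE]; apply/asboolP.
by exists (v ∘ g); rewrite gE.
Qed.

Let S := SubRepr M_closed D_closed act_closed.
Let D' : groupType := sub_grp S.

Let D_acts (d : D') : exists g, forall v, θ (v ∘ g) = θ v ∘ val d.
Proof. exact/asboolP/(valP d). Qed.

(** The choice is unique only up to elements acting trivially, so [γ] need not be multiplicative;
    the action it induces is, by injectivity of [θ]. *)
Let γ d := projT1 (cid (D_acts d)).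
Let γE d v : θ (v ∘ γ d) = θ v ∘ val d.
Proof. by rewrite /γ; case: cid. Qed.

Let actD (v : rmod A) (d : D') : rmod A := v ∘ γ d.

Let actD_linear d : linear (actD^~ d).
Proof. exact: kact_linear. Qed.
Let actD1 v : actD v 1%g = v.
Proof. by apply: inj_θ; rewrite γE kact1. Qed.
Let actDM v d e : actD v (d * e)%g = actD (actD v d) e.
Proof. by apply: inj_θ; rewrite !γE kactM. Qed.

(** Since [op_Qr] and [op_Q0] demand the identity on modules, the subrepresentation is transported
    from θV to the module of [A]. *)
Let AD : representation K := Representation (KAction actD_linear actD1 actDM).

Let AD_iso : representation_iso (representation_of_sub S) AD.
Proof.
apply: iso_sym.
have θM v : θ v \in M by apply/asboolP; exists v.
pose f (v : rmod AD) : rmod (representation_of_sub S) :=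
  (exist _ (θ v) (θM v) : sub_mod S).
have lf : linear f by move=> c u v; apply: val_inj; apply: linearP.
have fact v d : f (v ∘ d) = f v ∘ d by apply: val_inj; apply: γE.
exists (build_hom lf (@id_gmorphism D') fact); split; last by exists id.
have inv (w : sub_mod S) : exists v, θ v = val w by apply/asboolP/(valP w).
have [f' f'E] := choice inv.
exists f' => [v|w]; first by apply: inj_θ; rewrite f'E.
by apply: val_inj; apply: f'E.
Qed.

Lemma embed_operators (Y : repr_class K) : Y B -> op_Q0 (op_Qr (op_S Y)) A.
Proof.
move=> YB.
have YAD : op_S Y AD by exists B, S.
pose E := Representation (image_kaction (ract A)).
pose g (d : rgrp AD) : rgrp E := to_image (ract A) (γ d).
have mg : monoid.monoid_morphism g.
  split=> [|d e].
    by apply/to_image_eq => v; rewrite kact1; apply: actD1.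
  by rewrite -to_image_gmorphism; apply/to_image_eq => v; rewrite kactM; apply: actDM.
(* The step Q^0: the group of [A] maps onto its image. *)
exists (rmod A), (act_image (ract A)), (rgrp A), (image_kaction (ract A)), (ract A).
exists (@build_hom K (Representation (ract A)) E id _
  (@id_linear _ _) (to_image_gmorphism (ract A)) (fun _ _ => erefl)).
split=> //; last 2 first.
- by apply/seteqP; split=> // q _; have [x <-] := to_image_surj q; exists x.
- by exists (@build_hom K (Representation (ract A)) A id id
    (@id_linear _ _) (@id_gmorphism _) (fun _ _ => erefl)); split; exists id.
(* The step Q^r: [D'] maps onto the same image, by [θ_act]. *)
exists (rmod A), D', (act_image (ract A)), (ract AD), (image_kaction (ract A)).
exists (@build_hom K AD E id _ (@id_linear _ _) mg (fun _ _ => erefl)).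
split=> //; last exact: iso_refl.
apply/seteqP; split=> // q _; have [x <-] := to_image_surj q.
have [d dE] := θ_act x.
have dD : d \in D by apply/asboolP; exists x.
exists (exist _ d dD : sub_grp S) => //; apply/to_image_eq => v.
by apply: inj_θ; rewrite γE /= -dE.
Qed.

End Embedding.

(** * Equality of the two classes *)

Theorem corollary2 (K : comPzRingType) (X : repr_class K) :
  qVar_at X = op_Q0 (op_Qr (op_S (op_C (op_Cup X)))).
Proof.
apply/funext => A; apply/propext; split=> [XA|]; last exact: qVar_operators.
have [p [pV pG _]] := free_representation_universal
  (fun v : rmod A => v) (fun g : rgrp A => g).
have [B [h [XB hp]]] := kernel_hom XA p.
pose θ v := hom_mod h (free_gen K (rgrp A) v).
(* The generator of v and [w] differ by an element of ker p = ker h. Thus [h] factors as [θ] after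
   [p], which gives linearity and compatibility with the action. *)
have θE w v : hom_mod p w = v -> θ v = hom_mod h w.
  move=> pw; apply/eqP; rewrite -subr_eq0 -linearB; apply/eqP/hp.
  by rewrite linearB /= pV pw subrr.
have lθ : linear θ.
  move=> c u v; rewrite [RHS](_ : _ = hom_mod h (c *: free_gen K _ u + free_gen K _ v)).
    by apply: θE; rewrite linearP !pV.
  by rewrite linearP.
apply: (embed_operators (θ := build_linear lθ) _ _ XB) => /= [u v uv|g].
  rewrite -(pV u) -(pV v); apply/eqP; rewrite -subr_eq0 -linearB; apply/eqP/hp.
  by rewrite linearB /=; apply/eqP; rewrite subr_eq0; apply/eqP.
exists (hom_grp h (fg_gen g)) => v; rewrite -hom_act.
by apply: θE; rewrite hom_act pV pG.
Qed.
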